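(* Let $A$ be a Hopf algebra, $B$ a quantum homogeneous $A$-space, and $\Omega^1(B)\simeq A\,\square_{\pi_B}V^1$ a left $A$-covariant first-order differential calculus over $B$. Let $\mathcal{F}\in{}^A_B\mathrm{mod}_0$ and let $\nabla:\mathcal{F}\to\Omega^1(B)\otimes_B\mathcal{F}$ be a bimodule connection, whose bimodule map is denoted by $\sigma$. Assume that $\Omega^1(B)$ admits a framing calculus $\Omega^1(A)$ such that $vb=\varepsilon(b)v$ for all $b\in B$ and $v\in\Lambda^1$, where $\Lambda^1$ is the space of left-invariant forms of $\Omega^1(A)$. Then $$\Phi(\sigma)([f]\otimes[\mathrm{d}b])=[\mathrm{d}b]S(f_{(-1)})\otimes[f_{(0)}],\qquad\text{for all } b\in B,\ f\in\mathcal{F},$$ where $V^1$ is identified with its image in $\Lambda^1$.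
   Context: All algebras are unital over $\mathbb{C}$, Hopf algebras have bijective antipode $S$, $\Delta,\varepsilon$ denote coproduct and counit, Sweedler notation is used and left coactions are written $\Delta_L(f)=f_{(-1)}\otimes f_{(0)}$. A left coideal subalgebra $B\subseteq A$ is a quantum homogeneous $A$-space if $A$ is faithfully flat as a right $B$-module and $B^+A=AB^+$, where $B^+=\ker(\varepsilon|_B)$; put $\pi_B(A)=A/B^+A$, and let $\square_{\pi_B}$ be the cotensor product over $\pi_B(A)$. ${}^A_B\mathrm{mod}_0$ denotes the category of relative Hopf modules $\mathcal{F}$ (finitely generated left $B$-modules with a left $A$-coaction satisfying $\Delta_L(bf)=\Delta(b)\Delta_L(f)$) endowed with the right $B$-module structure $fb=f_{(-2)}bS(f_{(-1)})f_{(0)}$. Put $\Phi(\mathcal F)=\mathcal F/B^+\mathcal F$, with cosets written $[f]$; $\Phi(\mathcal F\otimes_B\mathcal G)$ is identified with $\Phi(\mathcal F)\otimes\Phi(\mathcal G)$ via $[f\otimes g]\leftrightarrow[f]\otimes[g]$, and $\Phi(\sigma)$ is the map induced by $\sigma$ on cosets. A first-order differential calculus (fodc) over an algebra $C$ is a $C$-bimodule $\Omega^1(C)$ with a derivation $\mathrm{d}:C\to\Omega^1(C)$ such that $\Omega^1(C)$ is generated as a left $C$-module by the elements $\mathrm{d}c$. For $C\in\{A,B\}$ it is left $A$-covariant if it has a left $A$-coaction with $\Delta_L(c\,\mathrm{d}c')=c_{(1)}c'_{(1)}\otimes c_{(2)}\mathrm{d}c'_{(2)}$. $V^1$ denotes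 $\Phi(\Omega^1(B))$. For a left $A$-covariant fodc $\Omega^1(A)$ over $A$, put $\Lambda^1:=\Omega^1(A)/A^+\Omega^1(A)$, where $A^+=\ker\varepsilon$ (the space of left-invariant forms), so that $\Omega^1(A)\simeq A\otimes\Lambda^1$; it is a right $A$-module via $[\omega]a=[\omega a]$. A left $A$-covariant fodc $\Omega^1(A)$ is a framing calculus for $\Omega^1(B)$ if $\Omega^1(B)$ is the restriction of $\Omega^1(A)$ to $B$ (i.e. $\Omega^1(B)=\mathrm{span}_B\{\mathrm{d}b\mid b\in B\}\subseteq\Omega^1(A)$), the vector space $V^1$ embeds into $\Lambda^1$ (via the map induced by this inclusion), and the image of $V^1$ is a right $A$-submodule of $\Lambda^1$. A connection on $\mathcal{F}$ is a linear map $\nabla:\mathcal{F}\to\Omega^1(B)\otimes_B\mathcal{F}$ with $\nabla(bf)=\mathrm{d}b\otimes f+b\nabla(f)$; it is a bimodule connection if there is a (necessarily unique) $B$-bimodule map $\sigma:\mathcal{F}\otimes_B\Omega^1(B)\to\Omega^1(B)\otimes_B\mathcal{F}$, called its bimodule map, with $\nabla(fb)=\nabla(f)b+\sigma(f\otimes\mathrm{d}b)$. *)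

(* Defs.v *)
From HB Require Import structures.
From mathcomp Require Import all_boot all_order all_algebra.
From mathcomp Require Import finmap.
From mathcomp Require Import boolp classical_sets functions reals.
From mathcomp Require Import complex.
From mathcomp.multinomials Require Import monalg.

Set Implicit Arguments.
Unset Strict Implicit.
Unset Printing Implicit Defensive.

Import GRing.Theory.

Local Open Scope ring_scope.
Local Open Scope quotient_scope.
Local Open Scope classical_set_scope.

Definition linspan (k : fieldType) (V : lmodType k) (S : set V) : {pred V} :=
  fun v => `[< exists (n : nat) (c : 'I_n -> k) (s : 'I_n -> V),
    (forall i, S (s i)) /\ v = \sum_i c i *: s i >].

Section Span.
Context (k : fieldType) (V : lmodType k) (S : set V).

Lemma linspan_sub v : S v -> v \in linspan S.
Proof.
move=> Sv; apply/asboolP; exists 1, (fun=> 1), (fun=> v).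
by split=> //; rewrite big_ord1 scale1r.
Qed.

Lemma linspan_submod : submod_closed (linspan S).
Proof.
split; first by apply/asboolP; exists 0, (fun=> 0), (fun=> 0); rewrite big_ord0;
  split=> // -[].
move=> a u v /asboolP[m [c [s [Ss ->]]]] /asboolP[n [d [t [St ->]]]].
apply/asboolP; exists (m + n).
exists (fun i => match fintype.split i with inl j => a * c j | inr j => d j end).
exists (fun i => match fintype.split i with inl j => s j | inr j => t j end).
split=> [i|]; first by case: (fintype.split i).
rewrite big_split_ord scaler_sumr /=; congr (_ + _).
  by apply: eq_bigr => i _; rewrite (unsplitK (inl _ i)) scalerA.
by apply: eq_bigr => i _; rewrite (unsplitK (inr _ i)).
Qed.

HB.instance Definition _ :=
  GRing.isSubmodClosed.Build k V (linspan S) linspan_submod.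

End Span.

Definition lquot (k : fieldType) (V : lmodType k) (S : set V) : Type :=
  Quotient.quot (linspan S : submodClosed V).

Section LQuot.
Context (k : fieldType) (V : lmodType k) (S : set V).

HB.instance Definition _ := ZmodQuotient.on (lquot S).

Definition lquot_scale (a : k) (x : lquot S) : lquot S :=
  \pi_(lquot S) (a *: repr x).

Lemma lquot_eq (x y : V) :
  (\pi_(lquot S) x = \pi_(lquot S) y) <-> (x - y \in linspan S).
Proof.
rewrite (Quotient.idealrBE (linspan S)). exact: (rwP eqP). Qed.

Lemma lquot_scale_pi a v : lquot_scale a (\pi_(lquot S) v) = \pi_(lquot S) (a *: v).
Proof.
apply/lquot_eq; rewrite -scalerBr rpredZ //.
by apply/lquot_eq; rewrite reprK.
Qed.

Let scaleA a b (x : lquot S) :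
  lquot_scale a (lquot_scale b x) = lquot_scale (a * b) x.
Proof.
by elim/quotW: x => x; rewrite [lquot_scale b _]lquot_scale_pi !lquot_scale_pi scalerA.
Qed.
Let scale1 : left_id 1 lquot_scale.
Proof. by move=> x; rewrite -[x]reprK lquot_scale_pi scale1r. Qed.
Let scaleDr : right_distributive lquot_scale +%R.
Proof.
by move=> a x y; rewrite -[x]reprK -[y]reprK -raddfD !lquot_scale_pi
  scalerDr raddfD.
Qed.
Let scaleDl x : {morph lquot_scale^~ x : a b / a + b}.
Proof.
by move=> a b /=; rewrite -[x]reprK !lquot_scale_pi scalerDl raddfD.
Qed.

HB.instance Definition _ :=
  GRing.Zmodule_isLmodule.Build k (lquot S) scaleA scale1 scaleDr scaleDl.

Lemma pi_lquot_linear : linear (\pi_(lquot S) : V -> lquot S).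
Proof.
by move=> a u v; rewrite raddfD; congr (_ + _); apply/esym/lquot_scale_pi.
Qed.

End LQuot.

Definition cls (k : fieldType) (V : lmodType k) (S : set V) (v : V) : lquot S :=
  \pi_(lquot S) v.

HB.instance Definition _ (k : fieldType) (V : lmodType k) (S : set V) :=
  GRing.isLinear.Build k V (lquot S) *:%R (@cls k V S) (@pi_lquot_linear k V S).

Definition bilin (k : fieldType) (U V W : lmodType k) (f : U -> V -> W) : Prop :=
  (forall v, linear (f^~ v)) /\ (forall u, linear (f u)).

(** Maps out of a quotient are defined on the chosen representatives; they do
    not depend on the choice when the relations are sent to [0]. *)
Definition qlift (k : fieldType) (V W : lmodType k) (S : set V) (f : V -> W)
    (x : lquot S) : W :=
  f (repr x).

Section QLift.
Context (k : fieldType) (V W : lmodType k) (S : set V) (f : V -> W).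
Hypotheses (flin : linear f) (fS : forall s, S s -> f s = 0).

Let fL : {linear V -> W} :=
  HB.pack f (GRing.isLinear.Build k V W *:%R f flin).

Lemma linspan_ker v : v \in linspan S -> f v = 0.
Proof.
case/asboolP=> n [c [s [Ss ->]]]; rewrite -[f]/(fL : V -> W) linear_sum.
by apply: big1 => i _; rewrite linearZ /= fS ?scaler0.
Qed.

Lemma qliftE v : qlift f (cls S v) = f v.
Proof.
apply/eqP; rewrite -subr_eq0 /qlift -[f]/(fL : V -> W) -raddfB /=.
by apply/eqP/linspan_ker/lquot_eq; rewrite reprK.
Qed.

Lemma qlift_linear : linear (qlift f : lquot S -> W).
Proof.
move=> a x y; elim/quotW: x => x; elim/quotW: y => y.
rewrite -[\pi x]/(cls S x) -[\pi y]/(cls S y) -[in LHS]linearP !qliftE.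
exact: flin.
Qed.

End QLift.

Definition tens_rel (k : fieldType) (M N : lmodType k) :
    set (malg (M * N)%type k) :=
  [set x |
    (exists a m m' n, x = << (a *: m + m', n) >>
                          - (a *: << (m, n) >> + << (m', n) >>)) \/
    (exists a m n n', x = << (m, a *: n + n') >>
                          - (a *: << (m, n) >> + << (m, n') >>))].

Definition tensor (k : fieldType) (M N : lmodType k) : Type :=
  lquot (@tens_rel k M N).

HB.instance Definition _ (k : fieldType) (M N : lmodType k) :=
  GRing.Lmodule.on (@tensor k M N).

Definition tens (k : fieldType) (M N : lmodType k) (m : M) (n : N) :
    tensor M N :=
  cls (@tens_rel k M N) << (m, n) >>.

Arguments tensor {k} (M N)%_type_scope.

Declare Scope tensor_scope.
Delimit Scope tensor_scope with T.
Notation "M ⊗ N" := (tensor M N)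
  (at level 40, left associativity) : type_scope.
Notation "m ⊗ n" := (tens m n)
  (at level 40, left associativity) : tensor_scope.
Local Open Scope tensor_scope.

(** [tlift f] is the linear map [m ⊗ n |-> f m n] attached to a bilinear [f]. *)
Definition free_lift (k : fieldType) (M N W : lmodType k) (f : M -> N -> W)
    (x : malg (M * N)%type k) : W :=
  \sum_(p <- msupp x) mcoeff p x *: f p.1 p.2.

Definition tlift (k : fieldType) (M N W : lmodType k) (f : M -> N -> W)
    (x : M ⊗ N) : W :=
  qlift (free_lift f) x.

Section TLift.
Context (k : fieldType) (M N : lmodType k).

Lemma tens_bilin : bilin (@tens k M N).
Proof.
by split=> [n a m m' | m a n n']; rewrite /tens -linearP; apply/lquot_eq;
  apply: linspan_sub; [left; exists a, m, m', n | right; exists a, m, n, n'].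
Qed.

Section Lift.
Context (W : lmodType k) (f : M -> N -> W).

Lemma free_lift_wide (d : {fset (M * N)%type}) x :
  fsubset (msupp x) d ->
  free_lift f x = \sum_(p <- d) mcoeff p x *: f p.1 p.2.
Proof.
move=> sxd; apply: big_fset_incl => // p _ /mcoeff_outdom ->.
exact: scale0r.
Qed.

Lemma free_lift_linear : linear (free_lift f).
Proof.
move=> a x y; set d := fsetU (fsetU (msupp x) (msupp y)) (msupp (a *: x + y)).
rewrite !(@free_lift_wide d) /d ?fsubsetUr //.
- rewrite scaler_sumr -big_split; apply: eq_bigr => p _ /=.
  by rewrite mcoeffD mcoeffZ scalerDl scalerA.
- by rewrite -fsetUA fsetUCA fsubsetUl.
- by rewrite -fsetUA fsubsetUl.
Qed.

Lemma free_liftU m n : free_lift f << (m, n) >> = f m n.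
Proof.
rewrite (free_lift_wide (msuppU_le)) big_seq_fset1 mcoeffUU.
exact: scale1r.
Qed.

Hypothesis f_bilin : bilin f.

Let free_lift_rel s : tens_rel s -> free_lift f s = 0.
Proof.
pose F : {linear malg (M * N)%type k -> W} :=
  HB.pack (free_lift f)
    (GRing.isLinear.Build k _ W *:%R (free_lift f) free_lift_linear).
rewrite -[free_lift f]/(F : _ -> _).
case=> -[a [m [m' [n ->]]]]; rewrite linearB linearP /= !free_liftU.
  by rewrite f_bilin.1 subrr.
by rewrite f_bilin.2 subrr.
Qed.

Lemma tliftE m n : tlift f (m ⊗ n) = f m n.
Proof.
by rewrite /tlift qliftE ?free_liftU //; apply: free_lift_linear.
Qed.

Lemma tlift_linear : linear (tlift f).
Proof. exact: (qlift_linear free_lift_linear free_lift_rel). Qed.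

End Lift.

Lemma tensZl (a : k) (m : M) (n : N) : (a *: m) ⊗ n = a *: (m ⊗ n).
Proof.
pose L : {linear M -> tensor M N} := HB.pack (fun m => m ⊗ n)
  (GRing.isLinear.Build k _ _ *:%R (fun m => m ⊗ n) (tens_bilin.1 n)).
exact: (linearZ_LR L a m).
Qed.

Lemma tens_sum (x : M ⊗ N) :
  exists s : seq (M * N), x = \sum_(p <- s) p.1 ⊗ p.2.
Proof.
elim/quotW: x => x; rewrite -[\pi x]/(cls (@tens_rel k M N) x).
rewrite [x]monalgE linear_sum.
exists [seq (mcoeff p x *: p.1, p.2) | p <- msupp x].
rewrite big_map; apply: eq_bigr => -[m n] _; rewrite [LHS]/= tensZl /tens.
rewrite -linearZ; congr (cls _ _); apply/malgP => p.
by rewrite mcoeffZ !mcoeffU mulr_natr.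
Qed.

Lemma tens_ext (W : lmodType k) (f g : M ⊗ N -> W) :
    linear f -> linear g -> (forall m n, f (m ⊗ n) = g (m ⊗ n)) ->
  f =1 g.
Proof.
move=> flin glin fg x.
pose F : {linear tensor M N -> W} := HB.pack f (GRing.isLinear.Build k _ _ *:%R f flin).
pose G : {linear tensor M N -> W} := HB.pack g (GRing.isLinear.Build k _ _ *:%R g glin).
have [s ->] := tens_sum x; rewrite -[f]/(F : _ -> _) -[g]/(G : _ -> _).
by rewrite !linear_sum; apply: eq_bigr => p _; apply: fg.
Qed.

End TLift.

Definition tmap (k : fieldType) (M M' N N' : lmodType k)
    (f : M -> M') (g : N -> N') : M ⊗ N -> M' ⊗ N' :=
  tlift (fun m n => f m ⊗ g n).

Definition tassoc (k : fieldType) (L M N : lmodType k) :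
    (L ⊗ M) ⊗ N -> L ⊗ (M ⊗ N) :=
  tlift (fun x n => tlift (fun l m => l ⊗ (m ⊗ n)) x).

(** [tmul f g (u ⊗ u') (v ⊗ v') = f u v ⊗ g u' v'] *)
Definition tmul (k : fieldType) (U V W U' V' W' : lmodType k)
    (f : U -> V -> W) (g : U' -> V' -> W') (x : U ⊗ U') (y : V ⊗ V') :
    W ⊗ W' :=
  tlift (fun u u' => tmap (f u) (g u') y) x.

Section TMap.
Context (k : fieldType) (M M' N N' : lmodType k) (f : M -> M') (g : N -> N').
Hypotheses (flin : linear f) (glin : linear g).

Lemma tmap_bilin : bilin (fun m n => f m ⊗ g n).
Proof.
split=> [n a m m' | m a n n'] /=.
  by rewrite flin; exact: (tens_bilin _ _).1.
by rewrite glin; exact: (tens_bilin _ _).2.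
Qed.

Lemma tmapE m n : tmap f g (m ⊗ n) = f m ⊗ g n.
Proof. exact: (tliftE tmap_bilin). Qed.

Lemma tmap_linear : linear (tmap f g).
Proof. exact: (tlift_linear tmap_bilin). Qed.

End TMap.

Definition is_laction (k : fieldType) (C : algType k) (M : lmodType k)
    (act : C -> M -> M) : Prop :=
  [/\ bilin act, forall m, act 1 m = m
    & forall a b m, act (a * b) m = act a (act b m)].

Definition is_raction (k : fieldType) (C : algType k) (M : lmodType k)
    (act : M -> C -> M) : Prop :=
  [/\ bilin act, forall m, act m 1 = m
    & forall m a b, act m (a * b) = act (act m a) b].

Record lmodule (k : fieldType) (C : algType k) := LModule {
  lmodule_sort :> lmodType k;
  lmodule_act : C -> lmodule_sort -> lmodule_sort;
  lmodule_axiom : is_laction lmodule_act }.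

Record bimodule (k : fieldType) (C : algType k) := Bimodule {
  bimodule_sort :> lmodType k;
  lact : C -> bimodule_sort -> bimodule_sort;
  ract : bimodule_sort -> C -> bimodule_sort;
  lact_axiom : is_laction lact;
  ract_axiom : is_raction ract;
  lract_comm : forall a m b, lact a (ract m b) = ract (lact a m) b }.

Notation "c ∙> m" := (lact c m) (at level 38, right associativity).
Notation "m <∙ c" := (ract m c) (at level 39, left associativity).

Definition is_bimodule_map (k : fieldType) (C : algType k) (M N : bimodule C)
    (f : M -> N) : Prop :=
  [/\ linear f, forall c m, f (c ∙> m) = c ∙> f m
    & forall m c, f (m <∙ c) = f m <∙ c].

Definition bal_rel (k : fieldType) (C : Type) (M N : lmodType k)
    (ra : M -> C -> M) (la : C -> N -> N) : set (M ⊗ N) :=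
  [set x | exists m c n, x = ra m c ⊗ n - m ⊗ la c n].

Definition btensor (k : fieldType) (C : Type) (M N : lmodType k)
    (ra : M -> C -> M) (la : C -> N -> N) : lmodType k :=
  lquot (bal_rel ra la).

Definition bmap (k : fieldType) (C : Type) (M M' N N' : lmodType k)
    (ra : M -> C -> M) (la : C -> N -> N)
    (ra' : M' -> C -> M') (la' : C -> N' -> N')
    (f : M -> M') (g : N -> N') (x : btensor ra la) : btensor ra' la' :=
  qlift (fun t => cls _ (tmap f g t)) x.

Arguments bmap {k C M M' N N' ra la ra' la'} f g x.

Lemma linear_comb (k : fieldType) (V W : lmodType k) (f g : V -> W) (a : k) :
  linear f -> linear g -> linear (fun x => a *: f x + g x).
Proof.
move=> flin glin b x y; rewrite flin glin !scalerDr !scalerA [a * b]mulrC.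
by rewrite addrACA.
Qed.

Lemma linear_compose (k : fieldType) (U V W : lmodType k) (f : V -> W)
    (g : U -> V) : linear f -> linear g -> linear (fun x => f (g x)).
Proof. by move=> flin glin a x y; rewrite glin flin. Qed.

Lemma btens_ext (k : fieldType) (C : Type) (M N W : lmodType k)
    (ra : M -> C -> M) (la : C -> N -> N) (f g : btensor ra la -> W) :
    linear f -> linear g ->
    (forall m n, f (cls (bal_rel ra la) (m ⊗ n))
               = g (cls (bal_rel ra la) (m ⊗ n))) ->
  f =1 g.
Proof.
move=> flin glin fg; elim/quotW=> x; rewrite -[\pi x]/(cls (bal_rel ra la) x).
have clin : linear (cls (bal_rel ra la)) by move=> a u v; rewrite linearP.
by move: x; apply: tens_ext fg; apply: linear_compose.
Qed.

Section BTensor.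
Context (k : fieldType) (C : algType k).

Section BMap.
Context (M M' N N' : lmodType k).
Context (ra : M -> C -> M) (la : C -> N -> N).
Context (ra' : M' -> C -> M') (la' : C -> N' -> N').
Context (f : M -> M') (g : N -> N').
Hypotheses (flin : linear f) (glin : linear g).
Hypotheses (fra : forall m c, f (ra m c) = ra' (f m) c).
Hypotheses (gla : forall c n, g (la c n) = la' c (g n)).

Let h_linear : linear (fun t => cls (bal_rel ra' la') (tmap f g t)).
Proof. by move=> a x y; rewrite tmap_linear // linearP. Qed.

Let h_rel s : bal_rel ra la s -> cls (bal_rel ra' la') (tmap f g s) = 0.
Proof.
move=> [m [c [n ->]]].
pose H : {linear tensor M N -> tensor M' N'} := HB.pack (tmap f g)
  (GRing.isLinear.Build k _ _ *:%R (tmap f g) (tmap_linear flin glin)).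
rewrite -[tmap f g]/(H : _ -> _) linearB /= !tmapE // fra gla.
rewrite -[RHS](linear0 (cls (bal_rel ra' la'))); apply/lquot_eq; rewrite subr0.
by apply: linspan_sub; exists (f m), c, (g n).
Qed.

Lemma bmap_linear : linear (bmap f g : btensor ra la -> btensor ra' la').
Proof. exact: (qlift_linear h_linear h_rel). Qed.

Lemma bmapE t :
  bmap f g (cls (bal_rel ra la) t) = cls (bal_rel ra' la') (tmap f g t).
Proof. exact: (qliftE h_linear h_rel). Qed.

End BMap.

Section BimoduleTensor.
Context (M N : bimodule C).

Let T := btensor (@ract k C M) (@lact k C N).

Definition btens_lact (c : C) (x : T) : T := bmap (lact c) idfun x.
Definition btens_ract (x : T) (c : C) : T := bmap idfun ((@ract k C N)^~ c) x.

Let idlin (V : lmodType k) : linear (@idfun V).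
Proof. by []. Qed.

Lemma btens_lactE c m n :
  btens_lact c (cls _ (m ⊗ n)) = cls (bal_rel _ _) ((c ∙> m) ⊗ n).
Proof.
have [[_ llin] _ _] := lact_axiom M.
rewrite /btens_lact bmapE ?tmapE // => m' c'; exact: lract_comm.
Qed.

Lemma btens_ractE m n c :
  btens_ract (cls _ (m ⊗ n)) c = cls (bal_rel _ _) (m ⊗ (n <∙ c)).
Proof.
have [[rlin _] _ _] := ract_axiom N.
rewrite /btens_ract bmapE ?tmapE // => c' n'; exact/esym/lract_comm.
Qed.

Lemma btens_lact_linear c : linear (btens_lact c).
Proof.
have [[_ llin] _ _] := lact_axiom M.
by apply: bmap_linear => // m' c'; exact: lract_comm.
Qed.

Lemma btens_ract_linear c : linear (btens_ract^~ c).
Proof.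
have [[rlin _] _ _] := ract_axiom N.
by apply: bmap_linear => // c' n'; exact/esym/lract_comm.
Qed.

Lemma btens_lact_axiom : is_laction btens_lact.
Proof.
have [[llin _] l1 lM] := lact_axiom M; split.
- split=> [x a c c'|]; last exact: btens_lact_linear.
  move: x; apply: btens_ext => [||m n].
  + exact: btens_lact_linear.
  + by apply: linear_comb; exact: btens_lact_linear.
  + rewrite !btens_lactE llin (tens_bilin _ _).1; exact: linearP.
- apply: btens_ext => [||m n]; first exact: btens_lact_linear.
    exact: idlin.
  by rewrite btens_lactE l1.
- move=> a b; apply: btens_ext => [||m n]; first exact: btens_lact_linear.
    by apply: linear_compose; exact: btens_lact_linear.
  by rewrite !btens_lactE lM.
Qed.

Lemma btens_ract_axiom : is_raction btens_ract.
Proof.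
have [[_ rlin] r1 rM] := ract_axiom N; split.
- split=> [|x a c c']; first exact: btens_ract_linear.
  move: x; apply: btens_ext => [||m n].
  + exact: btens_ract_linear.
  + by apply: linear_comb; exact: btens_ract_linear.
  + rewrite !btens_ractE rlin (tens_bilin _ _).2; exact: linearP.
- apply: btens_ext => [||m n]; first exact: btens_ract_linear.
    exact: idlin.
  by rewrite btens_ractE r1.
- move=> x a b; move: x; apply: btens_ext => [||m n].
  + exact: btens_ract_linear.
  + exact: (linear_compose (btens_ract_linear b) (btens_ract_linear a)).
  + by rewrite !btens_ractE rM.
Qed.

Lemma btens_lract_comm a x b :
  btens_lact a (btens_ract x b) = btens_ract (btens_lact a x) b.
Proof.
move: x; apply: btens_ext => [||m n].
- exact: (linear_compose (btens_lact_linear a) (btens_ract_linear b)).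
- exact: (linear_compose (btens_ract_linear b) (btens_lact_linear a)).
- by rewrite btens_ractE !btens_lactE btens_ractE.
Qed.

Definition bimod_tensor : bimodule C :=
  Bimodule btens_lact_axiom btens_ract_axiom btens_lract_comm.

Definition btens (m : M) (n : N) : bimod_tensor := cls _ (m ⊗ n).

End BimoduleTensor.

End BTensor.

Notation "M ⊗[ C ] N" := (@bimod_tensor _ C M N)
  (at level 40, C at level 200, left associativity, format "M  ⊗[ C ]  N")
  : type_scope.
Notation "m ⊗[ C ] n" := (@btens _ C _ _ m n)
  (at level 40, C at level 200, left associativity, format "m  ⊗[ C ]  n")
  : tensor_scope.

HB.mixin Record Algebra_isHopf (k : fieldType) A of GRing.Algebra k A := {
  Delta : A -> A ⊗ A;
  counit : A -> k;
  antipode : A -> A;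
  Delta_linear : linear Delta;
  Delta1 : Delta 1 = 1 ⊗ 1;
  DeltaM : forall a b, Delta (a * b) = tmul *%R *%R (Delta a) (Delta b);
  counit_linear : linear (counit : A -> k^o);
  counit1 : counit 1 = 1;
  counitM : forall a b, counit (a * b) = counit a * counit b;
  DeltaA : forall a,
    tassoc (tmap Delta idfun (Delta a)) = tmap idfun Delta (Delta a);
  Delta_counitl : forall a, tlift (fun x y => counit x *: y) (Delta a) = a;
  Delta_counitr : forall a, tlift (fun x y => counit y *: x) (Delta a) = a;
  antipode_linear : linear antipode;
  antipodel : forall a,
    tlift (fun x y => antipode x * y) (Delta a) = counit a *: 1;
  antipoder : forall a,
    tlift (fun x y => x * antipode y) (Delta a) = counit a *: 1;
  antipode_bij : bijective antipode
}.

#[short(type="hopfAlgType")]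
HB.structure Definition HopfAlgebra (k : fieldType) :=
  {A of Algebra_isHopf k A & GRing.Algebra k A}.

Definition is_lcomodule (k : fieldType) (A : hopfAlgType k) (M : lmodType k)
    (delta : M -> A ⊗ M) : Prop :=
  [/\ linear delta,
      forall m,
        tassoc (tmap Delta idfun (delta m)) = tmap idfun delta (delta m)
    & forall m, tlift (fun a m' => counit a *: m') (delta m) = m].

Definition exact_at (U V W : Type) (z : W) (f : U -> V) (g : V -> W) : Prop :=
  forall v, g v = z <-> exists u, f u = v.

Definition is_lmodule_map (k : fieldType) (C : algType k) (M N : lmodule C)
    (f : M -> N) : Prop :=
  linear f /\ forall c m, f (lmodule_act c m) = lmodule_act c (f m).

Definition faithfully_flat (k : fieldType) (C : algType k) (X : lmodType k)
    (ra : X -> C -> X) : Prop :=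
  forall (M1 M2 M3 : lmodule C) (f : M1 -> M2) (g : M2 -> M3),
    is_lmodule_map f -> is_lmodule_map g ->
    exact_at 0 f g <->
    exact_at 0
      (bmap idfun f : btensor ra (@lmodule_act k C M1) ->
                      btensor ra (@lmodule_act k C M2))
      (bmap idfun g : btensor ra (@lmodule_act k C M2) ->
                      btensor ra (@lmodule_act k C M3)).

Section QuantumHomogeneousSpace.
Context (k : fieldType) (A : hopfAlgType k) (P : {pred A}) (B : subAlgType P).

Definition left_coideal : Prop :=
  forall b : B, exists t : A ⊗ B, tmap idfun \val t = Delta (\val b).

(** The coproduct of [A] restricted to [B -> A ⊗ B]; [A ⊗ B -> A ⊗ A] being
    injective, it is determined by [left_coideal]. *)
Definition coB (b : B) : A ⊗ B :=
  xget 0 [set t : A ⊗ B | tmap idfun \val t = Delta (\val b)].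

Definition counitB (b : B) : k := counit (\val b).

Definition BplusA : set A :=
  [set x | exists (b : B) (a : A), counitB b = 0 /\ x = \val b * a].

Definition AplusB : set A :=
  [set x | exists (a : A) (b : B), counitB b = 0 /\ x = a * \val b].

Definition quantum_homogeneous_space : Prop :=
  [/\ left_coideal,
      faithfully_flat (fun (a : A) (b : B) => a * \val b)
    & forall x, (x \in linspan BplusA) = (x \in linspan AplusB)].

Definition piB : lmodType k := lquot BplusA.

End QuantumHomogeneousSpace.

Arguments coB {k A P} B b.
Arguments BplusA {k A P} B _.
Arguments AplusB {k A P} B _.

Definition plus_rel (k : fieldType) (C : algType k) (eps : C -> k)
    (M : bimodule C) : set M :=
  [set x | exists c m, eps c = 0 /\ x = c ∙> m].

Arguments plus_rel {k C} eps M _.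

Definition fibre (k : fieldType) (C : algType k) (eps : C -> k)
    (M : bimodule C) : lmodType k :=
  lquot (plus_rel eps M).

Definition fcls (k : fieldType) (C : algType k) (eps : C -> k)
    (M : bimodule C) (m : M) : fibre eps M :=
  cls (plus_rel eps M) m.

Section Phi.
Context (k : fieldType) (A : hopfAlgType k) (P : {pred A}) (B : subAlgType P).

Definition Phi (M : bimodule B) : lmodType k := fibre (@counitB k A P B) M.

Arguments Phi M%_type_scope.

Definition Phi_cls (M : bimodule B) (m : M) : Phi M := fcls _ m.

Definition Phi_map (M N : bimodule B) (f : M -> N) (x : Phi M) : Phi N :=
  qlift (fun m => Phi_cls (f m)) x.

(** The identification [[m ⊗ n] <-> [m] ⊗ [n]], in both directions; it is well
    defined as soon as [[m b] = eps(b) [m]] in [Phi M], see [Phi_tens_toE] and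
    [Phi_tens_ofE]. *)
Definition Phi_tens_to (M N : bimodule B) (x : Phi (M ⊗[B] N)) :
    Phi M ⊗ Phi N :=
  qlift (qlift (tmap (@Phi_cls M) (@Phi_cls N))) x.

Definition Phi_tens_of (M N : bimodule B) :
    Phi M ⊗ Phi N -> Phi (M ⊗[B] N) :=
  tlift (fun u v => Phi_cls (qlift idfun u ⊗[B] qlift idfun v)).

Definition Phi_tens_map (M N M' N' : bimodule B)
    (f : M ⊗[B] N -> M' ⊗[B] N') (x : Phi M ⊗ Phi N) : Phi M' ⊗ Phi N' :=
  Phi_tens_to (Phi_map f (Phi_tens_of x)).

Lemma Phi_cls_linear (M : bimodule B) : linear (@Phi_cls M).
Proof. by move=> a u v; rewrite /Phi_cls /fcls linearP. Qed.

Lemma Phi_cls_lact (M : bimodule B) (b : B) (m : M) :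
  Phi_cls (b ∙> m) = counitB b *: Phi_cls m.
Proof.
have [[llin _] l1 _] := lact_axiom M.
have := Phi_cls_linear (counitB b) m 0.
rewrite addr0 -[X in _ = _ + X](_ : 0 = _) ?addr0 => [<-|]; last first.
  by rewrite /Phi_cls /fcls linear0.
apply/lquot_eq/linspan_sub; exists (b - (counitB b)%:A), m; split.
  rewrite /counitB linearB linearZ /= rmorph1.
  rewrite addrC -scaleNr counit_linear counit1.
  by rewrite /GRing.scale /= mulr1 addNr.
rewrite (_ : b - (counitB b)%:A = (- counitB b) *: 1 + b).
  by rewrite llin l1 scaleNr addrC.
by rewrite scaleNr addrC.
Qed.

Lemma Phi_tens_toE (M N : bimodule B) (m : M) (n : N) :
    (forall (m : M) (b : B), Phi_cls (m <∙ b) = counitB b *: Phi_cls m) ->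
  Phi_tens_to (Phi_cls (m ⊗[B] n)) = Phi_cls m ⊗ Phi_cls n.
Proof.
move=> Mr; set f := tmap (@Phi_cls M) (@Phi_cls N).
have flin : linear f by apply: tmap_linear; exact: Phi_cls_linear.
have fE u v : f (u ⊗ v) = Phi_cls u ⊗ Phi_cls v.
  by apply: tmapE; exact: Phi_cls_linear.
have fB x y : f (x - y) = f x - f y.
  by rewrite addrC -scaleN1r flin scaleN1r addrC.
have f_rel s : bal_rel (@ract k B M) (@lact k B N) s -> f s = 0.
  case=> u [c [v ->]]; rewrite fB !fE Mr Phi_cls_lact.
  rewrite tensZl -[X in _ - X](_ : counitB c *: (Phi_cls u ⊗ Phi_cls v) = _).
    by rewrite subrr.
  pose L : {linear Phi N -> tensor (Phi M) (Phi N)} := HB.pack (tens (Phi_cls u))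
    (GRing.isLinear.Build k _ _ *:%R (tens (Phi_cls u))
      ((tens_bilin (Phi M) (Phi N)).2 (Phi_cls u))).
  by rewrite -(linearZ_LR L).
have glin := qlift_linear flin f_rel.
have gE t := qliftE flin f_rel t.
rewrite [LHS](qliftE glin) => [|s [c [x [c0 ->]]]]; first by rewrite gE fE.
have lin0 : linear (fun _ : M ⊗[B] N => 0 : Phi M ⊗ Phi N).
  by move=> a u v; rewrite scaler0 addr0.
have llin : linear (fun x : M ⊗[B] N => qlift f (c ∙> x)).
  by apply: (linear_compose glin); exact: btens_lact_linear.
move: x; apply: (btens_ext llin lin0) => u v.
rewrite [_ ∙> _]btens_lactE gE fE Phi_cls_lact c0 tensZl.
exact: scale0r.
Qed.

Lemma Phi_tens_ofE (M N : bimodule B) (m : M) (n : N) :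
    (forall (m : M) (b : B), Phi_cls (m <∙ b) = counitB b *: Phi_cls m) ->
  Phi_tens_of (Phi_cls m ⊗ Phi_cls n) = Phi_cls (m ⊗[B] n).
Proof.
move=> Mr; pose G (u : M) (v : N) := Phi_cls (u ⊗[B] v).
have Gl v : linear (G^~ v).
  move=> a u u'; rewrite /G /Phi_cls /fcls /btens.
  by rewrite (tens_bilin _ _).1 !linearP.
have Gr u : linear (G u).
  move=> a v v'; rewrite /G /Phi_cls /fcls /btens.
  by rewrite (tens_bilin _ _).2 !linearP.
have Gl0 v u : plus_rel (@counitB k A P B) M u -> G u v = 0.
  case=> c [w [c0 ->]]; rewrite /G.
  rewrite -[_ ⊗[B] _](btens_lactE c w v) -[btens_lact _ _]/(c ∙> (w ⊗[B] v)).
  by rewrite Phi_cls_lact c0 scale0r.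
have Gr0 u v : plus_rel (@counitB k A P B) N v -> G u v = 0.
  case=> c [w [c0 ->]].
  have -> : G u (c ∙> w) = G (u <∙ c) w.
    rewrite /G /btens; congr Phi_cls; apply/esym/lquot_eq.
    by apply: linspan_sub; exists u, c, w.
  apply: (linspan_ker (Gl w) (Gl0 w)); rewrite -[u <∙ c]subr0.
  apply/lquot_eq; have := Mr u c.
  by rewrite c0 scale0r -(linear0 (cls (plus_rel (@counitB k A P B) M))).
have hE (u : M) (v : N) :
    Phi_cls (qlift idfun (Phi_cls u) ⊗[B] qlift idfun (Phi_cls v)) = G u v.
  exact: etrans (qliftE (Gl (qlift idfun (Phi_cls v))) (Gl0 _) u)
                (qliftE (Gr u) (Gr0 u) v).
rewrite /Phi_tens_of tliftE ?hE //; split=> [y a x x' | x a y y'].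
- elim/quotW: x => x; elim/quotW: x' => x'; elim/quotW: y => y.
  rewrite -[\pi x]/(Phi_cls x) -[\pi x']/(Phi_cls x') -[\pi y]/(Phi_cls y).
  by rewrite -(Phi_cls_linear a x x') !hE Gl.
- elim/quotW: x => x; elim/quotW: y => y; elim/quotW: y' => y'.
  rewrite -[\pi x]/(Phi_cls x) -[\pi y]/(Phi_cls y) -[\pi y']/(Phi_cls y').
  by rewrite -(Phi_cls_linear a y y') !hE Gr.
Qed.

End Phi.

Arguments Phi {k A P B} M%_type_scope.

Section RelativeHopfModules.
Context (k : fieldType) (A : hopfAlgType k) (P : {pred A}) (B : subAlgType P).

Definition adj (a x : A) : A :=
  tlift (fun a1 a2 => a1 * x * antipode a2) (Delta a).

Definition fin_gen (M : bimodule B) : Prop :=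
  exists (n : nat) (g : 'I_n -> M),
    forall m, exists c : 'I_n -> B, m = \sum_i c i ∙> g i.

(** The field [rel_ract] reads [f b = f_(-2) b S(f_(-1)) f_(0)], where
    [t] is [f_(-2) b S(f_(-1)) ⊗ f_(0)] seen in [B ⊗ F], a subspace of
    [A ⊗ F]. *)
Record relHopfModule := RelHopfModule {
  rel_sort :> bimodule B;
  rel_coact : rel_sort -> A ⊗ rel_sort;
  rel_comodule : is_lcomodule rel_coact;
  rel_coactM : forall b f,
    rel_coact (b ∙> f) =
      tmul *%R (@lact k B rel_sort) (coB B b) (rel_coact f);
  rel_ract : forall f b, exists t : B ⊗ rel_sort,
    tmap \val idfun t =
      tlift (fun a f0 => adj a (\val b) ⊗ f0) (rel_coact f) /\
    f <∙ b = tlift (@lact k B rel_sort) t;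
  rel_fin_gen : fin_gen rel_sort }.

End RelativeHopfModules.

Record fodc (k : fieldType) (C : algType k) := Fodc {
  fodc_sort :> bimodule C;
  dif : C -> fodc_sort;
  dif_linear : linear dif;
  dif_leibniz : forall a b, dif (a * b) = dif a <∙ b + a ∙> dif b;
  dif_gen : forall w, w \in linspan [set a ∙> dif b | a in setT & b in setT] }.

(** A left [A]-covariant calculus over [C], where [coC : C -> A ⊗ C] is
    [Delta] if [C = A] and [coB] if [C = B]. *)
Record covFodc (k : fieldType) (A : hopfAlgType k) (C : algType k)
    (coC : C -> A ⊗ C) := CovFodc {
  cov_sort :> fodc C;
  cov_coact : cov_sort -> A ⊗ cov_sort;
  cov_comodule : is_lcomodule cov_coact;
  cov_coactM : forall a b,
    cov_coact (a ∙> dif cov_sort b) =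
      tmul *%R (fun x y => x ∙> dif cov_sort y) (coC a) (coC b) }.

Section Calculi.
Context (k : fieldType) (A : hopfAlgType k) (P : {pred A}) (B : subAlgType P).
Context (Om : covFodc (coB B)).

Definition Phi_coact (v : Phi Om) : piB B ⊗ Phi Om :=
  qlift (fun w => tmap (cls (BplusA B)) (@Phi_cls k A P B Om)
                       (cov_coact w)) v.

Definition cotensor : set (A ⊗ Phi Om) :=
  [set x | tassoc (tmap (fun a => tmap idfun (cls (BplusA B)) (Delta a))
                        idfun x)
         = tmap idfun Phi_coact x].

Definition cotensor_unit (w : Om) : A ⊗ Phi Om :=
  tmap idfun (@Phi_cls k A P B Om) (cov_coact w).

Definition is_connection (F : bimodule B) (nabla : F -> Om ⊗[B] F) : Prop :=
  linear nabla /\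
  forall b f, nabla (b ∙> f) = (dif Om b ⊗[B] f) + b ∙> nabla f.

Definition is_bimodule_connection (F : bimodule B) (nabla : F -> Om ⊗[B] F)
    (sigma : F ⊗[B] Om -> Om ⊗[B] F) : Prop :=
  [/\ is_connection nabla, is_bimodule_map sigma
    & forall f b, nabla (f <∙ b) = nabla f <∙ b + sigma (f ⊗[B] dif Om b)].

Context (OmA : covFodc (@Delta k A)).

Definition Lam : lmodType k := fibre (@counit k A) OmA.

Definition Lam_cls (w : OmA) : Lam := fcls _ w.

Definition Lam_ract (v : Lam) (a : A) : Lam :=
  qlift (fun w => Lam_cls (w <∙ a)) v.

Definition Lam_incl (j : Om -> OmA) (v : Phi Om) : Lam :=
  qlift (fun w => Lam_cls (j w)) v.

(** [j] is the inclusion of [Om] in [OmA]; as [Om] is spanned by the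
    [b ∙> dif b'], its image is the [B]-span of the [dif b'] in [OmA]. *)
Record is_framing (j : Om -> OmA) : Prop := IsFraming {
  framing_linear : linear j;
  framing_inj : injective j;
  framing_lact : forall b w, j (b ∙> w) = \val b ∙> j w;
  framing_ract : forall w b, j (w <∙ b) = j w <∙ \val b;
  framing_dif : forall b, j (dif Om b) = dif OmA (\val b);
  framing_embed : injective (Lam_incl j);
  framing_submod : forall v a, exists v',
    Lam_incl j v' = Lam_ract (Lam_incl j v) a }.

End Calculi.

Arguments cotensor {k A P B} Om _.
Arguments cotensor_unit {k A P B} Om w.

(* Main.v *)
From HB Require Import structures.
Require Import Defs.
From mathcomp Require Import all_boot all_order all_algebra.
From mathcomp Require Import boolp classical_sets functions reals.
From mathcomp Require Import complex.

Set Implicit Arguments.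
Unset Strict Implicit.
Unset Printing Implicit Defensive.

Local Open Scope ring_scope.
Local Open Scope tensor_scope.
Local Open Scope quotient_scope.

Import GRing.Theory.

(** The formula comes from computing [nabla (f b)] in two ways.  Write
    [f b = sum_i b_i f_i], where [sum_i b_i ⊗ f_i] is
    [f_(-2) b S(f_(-1)) ⊗ f_(0)].  The right Leibniz rule, which defines
    [sigma], and the left one give
      [nabla f b + sigma (f ⊗ db) = sum_i (db_i ⊗ f_i + b_i nabla f_i)].
    Passing to fibres turns every action of [B], on either side, into
    multiplication by the counit.  Since the counit is invariant under the
    adjoint action ([counit_adj]), [sum_i eps(b_i) f_i = eps(b) f]
    ([rel_split_counit]), so the terms [nabla f b] and [sum_i b_i nabla f_i]
    have the same class and cancel.  There remains
      [Phi sigma ([f] ⊗ [db]) = sum_i [db_i] ⊗ [f_i]],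
    which is [Phi_tens_map_sigma].

    The right action on [Phi Om] is trivial because the framing embeds
    [Phi Om] in [Lam], where it is trivial by hypothesis
    ([Phi_cls_ract_framing]).  The classes [[db_i]] can then be computed in
    [Lam], as if [b_i] were [a_(1) b S(a_(2))] with [a = f_(-1)]: expanding
    [d] of this triple product by the Leibniz rule, [Lam_dif_adj] finds
    [[db] S(a)] plus [eps(b) [d(a_(1) S(a_(2)))]], and the latter is a multiple
    of [d1 = 0]. *)

(** * Linear functions and maps out of tensor products *)

Section LinearFunctions.
Context (k : fieldType) (V W : lmodType k) (h : V -> W).
Hypothesis hlin : linear h.

Let hL : {linear V -> W} :=
  HB.pack h (GRing.isLinear.Build k V W *:%R h hlin).

Lemma lin0 : h 0 = 0. Proof. exact: (linear0 hL). Qed.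

Lemma linD x y : h (x + y) = h x + h y. Proof. exact: (linearD hL). Qed.

Lemma linB x y : h (x - y) = h x - h y. Proof. exact: (linearB hL). Qed.

Lemma linZ a x : h (a *: x) = a *: h x. Proof. exact: (linearZ_LR hL). Qed.

(** As [tlift f x] is by construction a combination of values of [f], this
    holds for every [f]; bilinearity only matters for evaluating [tlift f] on a
    given tensor. *)
Lemma lin_tlift (M N : lmodType k) (f : M -> N -> V) x :
  h (tlift f x) = tlift (fun m n => h (f m n)) x.
Proof.
rewrite /tlift /qlift /free_lift -[h]/(hL : V -> W) linear_sum.
by apply: eq_bigr => p _; rewrite linearZ.
Qed.

End LinearFunctions.

Section Lifts.
Context (k : fieldType).

Lemma eq_tlift (M N W : lmodType k) (f g : M -> N -> W) x :
  (forall m n, f m n = g m n) -> tlift f x = tlift g x.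
Proof. by move=> fg; apply: eq_bigr => p _; rewrite fg. Qed.

Lemma tliftD (M N W : lmodType k) (f g : M -> N -> W) x :
  tlift (fun m n => f m n + g m n) x = tlift f x + tlift g x.
Proof.
by rewrite /tlift /qlift /free_lift -big_split; apply: eq_bigr => p _;
  rewrite scalerDr.
Qed.

Lemma tliftZ (M N W : lmodType k) (c : k) (f : M -> N -> W) x :
  tlift (fun m n => c *: f m n) x = c *: tlift f x.
Proof.
by apply/esym; apply: (@lin_tlift _ _ _ ( *:%R c)) => a u v;
  rewrite scalerDr !scalerA mulrC.
Qed.

Lemma tlift_tlift (L K M N W : lmodType k) (f : M -> N -> W)
    (g : L -> K -> M) (h : K -> N) x : bilin f ->
  tlift f (tlift (fun l m => g l m ⊗ h m) x)
  = tlift (fun l m => f (g l m) (h m)) x.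
Proof.
move=> fb; rewrite (lin_tlift (tlift_linear fb)).
by apply: eq_tlift => l m; rewrite tliftE.
Qed.

Lemma tlift_tmap (M M' N N' W : lmodType k) (f : M' -> N' -> W)
    (g : M -> M') (h : N -> N') x : bilin f ->
  tlift f (tmap g h x) = tlift (fun m n => f (g m) (h n)) x.
Proof.
move=> fb; rewrite /tmap (lin_tlift (tlift_linear fb)).
by apply: eq_tlift => m n; rewrite tliftE.
Qed.

Lemma scale_bilin (V W : lmodType k) (e : V -> k) :
  linear (e : V -> k^o) -> bilin (fun v (w : W) => e v *: w).
Proof.
move=> elin; split=> [w a u v | u a v w] /=.
  by rewrite elin scalerDl scalerA.
by rewrite scalerDr !scalerA mulrC.
Qed.

End Lifts.

(** * The counit and the adjoint action *)

Section Hopf.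
Context (k : fieldType) (A : hopfAlgType k).
Implicit Types a x : A.

Let epsL : linear (counit : A -> k^o) := counit_linear.

(** Apply the counit to the antipode axiom: [eps(S(a_(1))) eps(a_(2))] is
    [eps(S(a))], by counitality. *)
Lemma counit_antipode a : counit (antipode a) = counit a.
Proof.
have := congr1 (counit : A -> k^o) (antipodel a).
rewrite (lin_tlift epsL) (linZ epsL) counit1 [in RHS]/GRing.scale /= mulr1 => <-.
rewrite -[in LHS](Delta_counitr a).
rewrite (lin_tlift antipode_linear) (lin_tlift epsL).
apply: (@eq_tlift _ _ _ k^o) => x y.
by rewrite (linZ antipode_linear) (linZ epsL) counitM mulrC.
Qed.

Lemma counit_adj a x : counit (adj a x) = counit a * counit x.
Proof.
rewrite /adj (lin_tlift epsL).
transitivity (tlift (fun a1 a2 => counit x *: (counit (counit a2 *: a1) : k^o))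
    (Delta a)).
  apply: (@eq_tlift _ _ _ k^o) => a1 a2.
  rewrite !counitM counit_antipode (linZ epsL).
  by rewrite -mulrA mulrCA [counit a1 * _]mulrC.
by rewrite tliftZ -(lin_tlift epsL) Delta_counitr [RHS]mulrC.
Qed.

End Hopf.

(** * Differentials of adjoint translates among left-invariant forms *)

Section Calculus.
Context (k : fieldType) (C : algType k) (Om : fodc C).

Lemma dif1 : dif Om 1 = 0.
Proof.
have [_ l1 _] := lact_axiom Om; have [_ r1 _] := ract_axiom Om.
have := dif_leibniz Om 1 1; rewrite mulr1 l1 r1 => /eqP.
by rewrite -subr_eq0 opprD addNKr oppr_eq0 => /eqP.
Qed.

End Calculus.

Lemma fcls_lact0 (k : fieldType) (C : algType k) (eps : C -> k)
    (M : bimodule C) c (m : M) :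
  eps c = 0 -> fcls eps (c ∙> m) = 0.
Proof.
move=> c0; rewrite -[RHS](linear0 (cls (plus_rel eps M))); apply/lquot_eq.
by rewrite subr0; apply: linspan_sub; exists c, m.
Qed.

Section LeftInvariantForms.
Context (k : fieldType) (A : hopfAlgType k) (OmA : covFodc (@Delta k A)).

Lemma Lam_cls_linear : linear (@Lam_cls k A OmA).
Proof. by move=> a u v; rewrite /Lam_cls /fcls linearP. Qed.

Lemma Lam_cls_lact a (w : OmA) : Lam_cls (a ∙> w) = counit a *: Lam_cls w.
Proof.
have [[llin _] l1 _] := lact_axiom OmA.
rewrite -[a in LHS](subrK (counit a *: 1)) addrC llin l1 Lam_cls_linear.
rewrite [X in _ + X]fcls_lact0 ?addr0 //.
have epsL : linear (counit : A -> k^o) := counit_linear.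
apply: etrans (linB epsL _ _) _.
by rewrite (linZ epsL) counit1 [_ *: 1]mulr1 subrr.
Qed.

Lemma Lam_ractE (w : OmA) a : Lam_ract (Lam_cls w) a = Lam_cls (w <∙ a).
Proof.
have [[rlin _] _ _] := ract_axiom OmA.
apply: (qliftE (linear_compose Lam_cls_linear (rlin a))) => _ [c [u [c0 ->]]].
by rewrite -lract_comm Lam_cls_lact c0 scale0r.
Qed.

Lemma Lam_ract_bilin : bilin (@Lam_ract k A OmA).
Proof.
have [[rlinl rlinr] _ _] := ract_axiom OmA.
split=> [a c u v | v c a a'] /=; last first.
  elim/quotW: v => w; rewrite -[\pi w]/(Lam_cls w) !Lam_ractE.
  by rewrite rlinr Lam_cls_linear.
elim/quotW: u => u; elim/quotW: v => v.
rewrite -[\pi u]/(Lam_cls u) -[\pi v]/(Lam_cls v) -Lam_cls_linear !Lam_ractE.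
by rewrite rlinl Lam_cls_linear.
Qed.

(** On left-invariant forms the Leibniz rule reads
    [[d(yz)] = [dy] z + eps(y) [dz]].  Used on [a_(1) x S(a_(2))] it gives three
    terms.  As [x] acts by its counit, the two in which [x] is not
    differentiated are together [eps(x) [d(a_(1) S(a_(2)))]], that is
    [eps(x) eps(a) [d1] = 0]; the third is [[dx] S(a)] by counitality. *)
Lemma Lam_dif_adj (a x : A) :
    (forall v : Lam OmA, Lam_ract v x = counit x *: v) ->
  Lam_cls (dif OmA (adj a x)) = Lam_ract (Lam_cls (dif OmA x)) (antipode a).
Proof.
move=> xtriv; pose D y := Lam_cls (dif OmA y).
have Dlin : linear D := linear_compose Lam_cls_linear (@dif_linear _ _ OmA).
have [_ _ rM] := ract_axiom OmA.
have DM y z : D (y * z) = Lam_ract (D y) z + counit y *: D z.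
  by rewrite /D dif_leibniz (linD Lam_cls_linear) Lam_cls_lact Lam_ractE.
have ractM v y z : Lam_ract (OmA:=OmA) v (y * z) = Lam_ract (Lam_ract v y) z.
  by elim/quotW: v => w; rewrite -[\pi w]/(Lam_cls w) !Lam_ractE rM.
have Slin := linear_compose (Lam_ract_bilin.2 (D x)) (@antipode_linear k A).
rewrite -[LHS]/(D _) -[Lam_cls (dif OmA x)]/(D x) /adj (lin_tlift Dlin).
transitivity (tlift (fun a1 a2 => counit x *: D (a1 * antipode a2)
    + Lam_ract (D x) (antipode (counit a1 *: a2))) (Delta a)).
  apply: eq_tlift => a1 a2; rewrite -mulrA !DM ractM xtriv (linZ Slin).
  rewrite (linZ (Lam_ract_bilin.1 _)) !scalerDr addrA addrAC !scalerA.
  by rewrite [counit x * _]mulrC.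
rewrite tliftD -(lin_tlift Slin) Delta_counitl tliftZ -(lin_tlift Dlin).
rewrite antipoder (linZ Dlin) {1}/D dif1 (lin0 Lam_cls_linear).
by rewrite !scaler0 add0r.
Qed.

End LeftInvariantForms.

(** * Fibres of bimodules over [B] *)

Section Fibre.
Context (k : fieldType) (A : hopfAlgType k) (P : {pred A}) (B : subAlgType P).

(** The condition on [M] makes [[m] ⊗ [n]] vanish on the balancing relations;
    the fibre relations are killed by the left action on [[m]] alone. *)
Lemma Phi_tens_to_linear (M N : bimodule B) :
    (forall (m : M) (b : B), Phi_cls (m <∙ b) = counitB b *: Phi_cls m) ->
  linear (@Phi_tens_to k A P B M N).
Proof.
move=> Mr; pose h := tmap (@Phi_cls k A P B M) (@Phi_cls k A P B N).
have clin M' : linear (@Phi_cls k A P B M') by exact: Phi_cls_linear.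
have hlin : linear h by exact: tmap_linear.
have hE m n : h (m ⊗ n) = Phi_cls m ⊗ Phi_cls n by exact: tmapE.
have h_bal s : bal_rel (@ract k B M) (@lact k B N) s -> h s = 0.
  case=> m [c [n ->]]; rewrite (linB hlin) !hE Mr Phi_cls_lact tensZl.
  by rewrite (linZ ((tens_bilin _ _).2 _)) subrr.
have qlin := qlift_linear hlin h_bal.
apply: (qlift_linear qlin) => _ [c [x [c0 ->]]].
have zlin : linear (fun _ : M ⊗[B] N => 0 : Phi M ⊗ Phi N).
  by move=> a u v; rewrite scaler0 addr0.
move: x; apply: (btens_ext (linear_compose qlin (btens_lact_linear c)) zlin).
move=> m n; rewrite btens_lactE (qliftE hlin h_bal) hE Phi_cls_lact c0 tensZl.
exact: scale0r.
Qed.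

Lemma Phi_mapE (M N : bimodule B) (g : M -> N) (m : M) :
  is_bimodule_map g -> Phi_map g (Phi_cls m) = Phi_cls (g m).
Proof.
case=> glin gl _.
apply: (qliftE (linear_compose (@Phi_cls_linear _ _ _ _ N) glin)).
by move=> _ [c [u [c0 ->]]]; rewrite gl Phi_cls_lact c0 scale0r.
Qed.

(** The element [t] of [B ⊗ F] is the splitting of [f b] in terms of which the
    right action on a relative Hopf module is defined.  Its contraction with
    the counit of [B] can be computed in [A ⊗ F], where the counit does not see
    the adjoint action. *)
Lemma rel_split_counit (F : relHopfModule B) (b : B) (f : F) (t : B ⊗ F) :
    tmap \val idfun t
    = tlift (fun a f0 => adj a (\val b) ⊗ f0) (rel_coact f) ->
  tlift (fun b' f' => counitB b' *: f') t = counitB b *: f.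
Proof.
move=> tE; have ebil := scale_bilin F (@counit_linear k A).
have [_ _ Fcounit] := rel_comodule F.
rewrite -(tlift_tmap (\val : B -> A) idfun _ ebil) tE tlift_tlift //.
rewrite -[in RHS](Fcounit f) -tliftZ; apply: eq_tlift => a f0.
by rewrite counit_adj scalerA mulrC.
Qed.

Lemma Phi_cls_ract_rel (F : relHopfModule B) (f : F) (b : B) :
  Phi_cls (f <∙ b) = counitB b *: Phi_cls f.
Proof.
have clin := @Phi_cls_linear k A P B F.
have [t [tE ->]] := rel_ract f b.
rewrite -(linZ clin) -(rel_split_counit tE) !(lin_tlift clin).
by apply: eq_tlift => b' f'; rewrite Phi_cls_lact (linZ clin).
Qed.

Section Framing.
Context (Om : covFodc (coB B)) (OmA : covFodc (@Delta k A)) (j : Om -> OmA).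
Hypothesis j_framing : is_framing j.

Let jlin : linear (fun w => Lam_cls (j w)).
Proof.
exact: (linear_compose (@Lam_cls_linear _ _ OmA) (framing_linear j_framing)).
Qed.

Let j_plus w : plus_rel (@counitB k A P B) Om w -> Lam_cls (j w) = 0.
Proof.
case=> c [u [c0 ->]].
by rewrite (framing_lact j_framing) Lam_cls_lact [counit _]c0 scale0r.
Qed.

Lemma Lam_inclE w : Lam_incl j (Phi_cls w) = Lam_cls (j w).
Proof. exact: (qliftE jlin j_plus). Qed.

Lemma Lam_incl_linear : linear (Lam_incl j).
Proof. exact: (qlift_linear jlin j_plus). Qed.

(** The embedding of the fibre [Phi Om] in [Lam] is injective and turns the
    right [B]-action of [Om] into that of [Lam]. *)
Lemma Phi_cls_ract_framing (w : Om) (b : B) :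
    (forall v : Lam OmA, Lam_ract v (\val b) = counit (\val b) *: v) ->
  Phi_cls (w <∙ b) = counitB b *: Phi_cls w.
Proof.
move=> btriv; apply: (framing_embed j_framing).
rewrite (linZ Lam_incl_linear) !Lam_inclE (framing_ract j_framing).
by rewrite -Lam_ractE btriv.
Qed.

End Framing.

(** * The bimodule map of a connection on fibres *)

Section BimoduleConnection.
Context (Om : covFodc (coB B)) (F : relHopfModule B).
Context (nabla : F -> (Om ⊗[B] F)%type).
Context (sigma : (F ⊗[B] Om)%type -> (Om ⊗[B] F)%type).
Hypothesis nabla_sigma : is_bimodule_connection nabla sigma.

(** In the fibre, the terms of the two Leibniz rules that contain [nabla]
    both become [eps(b) [nabla f]], leaving the differentials of the
    [B]-components of the splitting [t] of [f b]. *)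
Lemma Phi_tens_map_sigma (b : B) (f : F) (t : B ⊗ F) :
    (forall (w : Om) (c : B), Phi_cls (w <∙ c) = counitB c *: Phi_cls w) ->
    tmap \val idfun t
    = tlift (fun a f0 => adj a (\val b) ⊗ f0) (rel_coact f) ->
    f <∙ b = tlift (@lact k B F) t ->
  Phi_tens_map sigma (Phi_cls f ⊗ Phi_cls (dif Om b))
  = tmap (fun b' => Phi_cls (dif Om b')) (@Phi_cls _ _ _ _ F) t.
Proof.
move=> Om_ract tE fbE; have [[nlin nleib] sbim nract] := nabla_sigma.
rewrite /Phi_tens_map (Phi_tens_ofE _ _ (@Phi_cls_ract_rel F)) Phi_mapE //.
pose T (x : Om ⊗[B] F) := Phi_tens_to (Phi_cls x).
have Tlin : linear T.
  exact: (linear_compose (Phi_tens_to_linear Om_ract)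
            (@Phi_cls_linear _ _ _ _ _)).
have TE w g : T (w ⊗[B] g) = Phi_cls w ⊗ Phi_cls g by exact: Phi_tens_toE.
have Tl c x : T (c ∙> x) = counitB c *: T x.
  by rewrite /T Phi_cls_lact (linZ (Phi_tens_to_linear Om_ract)).
have Zlin : linear (fun x => counitB b *: T x).
  by move=> c u v; rewrite Tlin scalerDr !scalerA mulrC.
have Tr : (fun x => T (x <∙ b)) =1 (fun x => counitB b *: T x).
  apply: (btens_ext (linear_compose Tlin (@btens_ract_linear _ _ _ _ b)) Zlin).
  move=> w g; rewrite btens_ractE.
  rewrite -[cls _ (w ⊗ (g <∙ b))]/(w ⊗[B] (g <∙ b)).
  by rewrite -[cls _ (w ⊗ g)]/(w ⊗[B] g) !TE Phi_cls_ract_rel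
     (linZ ((tens_bilin _ _).2 _)).
rewrite -[LHS]/(T _); apply: (addrI (T (nabla f <∙ b))).
rewrite -(linD Tlin) -nract Tr fbE (lin_tlift nlin) (lin_tlift Tlin).
have TNlin := linear_compose Tlin nlin.
rewrite -(linZ TNlin) -(rel_split_counit tE) (lin_tlift TNlin) -tliftD.
apply: eq_tlift => b' f'.
by rewrite nleib (linD Tlin) TE Tl (linZ TNlin) addrC.
Qed.

Lemma Phi_tens_map_sigma_framing (OmA : covFodc (@Delta k A)) (j : Om -> OmA)
    (b : B) (f : F) :
    is_framing j ->
    (forall (c : B) (v : Lam OmA),
      Lam_ract v (\val c) = counit (\val c) *: v) ->
  tmap (Lam_incl j) idfun
    (Phi_tens_map sigma (Phi_cls f ⊗ Phi_cls (dif Om b)))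
  = tlift (fun a f0 =>
      Lam_ract (Lam_incl j (Phi_cls (dif Om b))) (antipode a) ⊗ Phi_cls f0)
      (rel_coact f).
Proof.
move=> j_framing Lam_triv.
have Om_ract (w : Om) c : Phi_cls (w <∙ c) = counitB c *: Phi_cls w.
  exact: (Phi_cls_ract_framing j_framing).
have [t [tE fbE]] := rel_ract f b.
have incl_dif c : Lam_incl j (Phi_cls (dif Om c)) = Lam_cls (dif OmA (\val c)).
  by rewrite Lam_inclE // (framing_dif j_framing).
rewrite (Phi_tens_map_sigma Om_ract tE fbE) incl_dif.
have Flin := @Phi_cls_linear _ _ _ _ F.
have dlin := linear_compose (@Lam_cls_linear _ _ OmA) (@dif_linear _ _ OmA).
have dFbil := tmap_bilin dlin Flin.
have idlin : linear (@idfun (Phi F)) by [].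
have iFbil := tmap_bilin (Lam_incl_linear j_framing) idlin.
apply: etrans (tlift_tmap _ _ _ iFbil) _.
(* Through [\val] the splitting [t] of [f b] becomes an element of [A ⊗ F] that
   the adjoint action gives explicitly; [d] has to be taken in [OmA] there. *)
transitivity (tmap (fun x => Lam_cls (dif OmA x)) (@Phi_cls _ _ _ _ F)
    (tmap \val idfun t)).
  apply: etrans (esym (tlift_tmap (\val : B -> A) idfun t dFbil)).
  by apply: eq_tlift => b' f' /=; congr (_ ⊗ _); exact: incl_dif.
rewrite tE; apply: etrans (tlift_tlift _ _ _ dFbil) _.
by apply: eq_tlift => a f0 /=; congr (_ ⊗ _); apply: Lam_dif_adj.
Qed.

End BimoduleConnection.

End Fibre.

Theorem proposition4p10 (R : realType) (A : hopfAlgType R[i])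
  (P : {pred A}) (B : subAlgType P)
  (B_qhs : quantum_homogeneous_space B)
  (Om : covFodc (coB B))
  (Om_cotensor : set_bij setT (cotensor Om) (cotensor_unit Om))
  (F : relHopfModule B)
  (nabla : F -> (Om ⊗[B] F)%type) (sigma : (F ⊗[B] Om)%type -> (Om ⊗[B] F)%type)
  (nabla_sigma : is_bimodule_connection nabla sigma)
  (OmA : covFodc (@Delta _ A))
  (j : Om -> OmA)
  (j_framing : is_framing j)
  (Lam_triv : forall (b : B) (v : Lam OmA),
    Lam_ract v (\val b) = counit (\val b) *: v)
  (b : B) (f : F) :
  tmap (Lam_incl j) idfun
    (Phi_tens_map sigma (Phi_cls f ⊗ Phi_cls (dif Om b)))
  = tlift (fun a f0 =>
      Lam_ract (Lam_incl j (Phi_cls (dif Om b))) (antipode a) ⊗ Phi_cls f0)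
      (rel_coact f).
Proof. exact: (Phi_tens_map_sigma_framing nabla_sigma). Qed.
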